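(* Let $R$ be a finite $7$-centralizer ring such that $R/Z(R)$ is not isomorphic to $\mathbb{Z}_2 \times \mathbb{Z}_2 \times \mathbb{Z}_6$. Then $\Pr(R) = \frac{29}{125}$.
   Context: Rings are associative; no identity element is assumed. For a finite ring $R$ and $x \in R$, the centralizer of $x$ is $C_R(x) = \{s \in R : xs = sx\}$, and the center is $Z(R) = \bigcap_{x \in R} C_R(x)$. Put $\operatorname{Cent}(R) = \{C_R(x) : x \in R\}$; $R$ is called $n$-centralizer if $|\operatorname{Cent}(R)| = n$. The commuting probability of $R$ is $\Pr(R) = \frac{|\{(r,s) \in R \times R : rs = sr\}|}{|R|^2}$. $R/Z(R)$ denotes the quotient of the additive group $(R,+)$ by its subgroup $(Z(R),+)$, and isomorphisms are isomorphisms of additive groups. $\mathbb{Z}_m$ is the cyclic group of order $m$. *)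

(* Defs.v *)
From HB Require Import structures.
From mathcomp Require Import all_boot all_order all_algebra all_fingroup.

Set Implicit Arguments.
Unset Strict Implicit.
Unset Printing Implicit Defensive.

Import GRing.Theory.
Local Open Scope ring_scope.

(* The ring structures of MathComp all have an identity element, hence this
   record: a finite abelian group with an associative biadditive product. *)
Record finRng := FinRng {
  finRng_zmod :> finZmodType;
  rmul : finRng_zmod -> finRng_zmod -> finRng_zmod;
  rmulA : associative rmul;
  rmulDl : left_distributive rmul +%R;
  rmulDr : right_distributive rmul +%R
}.

Definition rcentralizer (R : finRng) (x : R) : {set R} :=
  [set s : R | rmul x s == rmul s x].

Definition rcenter (R : finRng) : {set R} := \bigcap_(x : R) rcentralizer x.

Definition rCent (R : finRng) : {set {set R}} :=
  [set rcentralizer x | x : R].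

Definition n_centralizer (n : nat) (R : finRng) : Prop := #|rCent R| = n.

Definition commuting_probability (R : finRng) : rat :=
  #|[set rs : R * R | rmul rs.1 rs.2 == rmul rs.2 rs.1]|%:R / (#|R| ^ 2)%:R.

(* Every finZmodType is canonically a finGroupType whose group law is +; the
   group-theoretic notions below all refer to this additive group. *)
Lemma rcenter_group_set (R : finRng) : group_set (rcenter R).
Proof.
have mul0 (x : R) : rmul x 0 = 0.
  by apply: (addrI (rmul x 0)); rewrite -rmulDr !addr0.
have mul0l (x : R) : rmul 0 x = 0.
  by apply: (addrI (rmul 0 x)); rewrite -rmulDl !addr0.
apply/group_setP; split.
  by apply/bigcapP => x _; rewrite inE [1%g]/(0 : R) mul0 mul0l.
move=> a b /bigcapP aZ /bigcapP bZ; apply/bigcapP => x _.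
have := aZ x isT; have := bZ x isT; rewrite !inE => /eqP bx /eqP ax.
by rewrite [(a * b)%g]/(a + b : R) rmulDr rmulDl ax bx.
Qed.

Canonical rcenter_group (R : finRng) : {group R} :=
  Group (rcenter_group_set R).

(* Main.v *)
(** Write [x, y] = xy - yx and Z for the centre.  If two elements u, v of the
    centralizer of a non-central x did not commute, then R, C(x), C(u), C(v),
    C(u+v), C(y), C(x+y), for any y outside C(x), would be all the centralizers;
    locating C(x+u) and C(y+u) in this list forces [y, u] = [y, x], and likewise
    [y, v] = [y, u+v] = [y, x], so that [y, x] = 0.  Hence proper centralizers
    are abelian, and the six of them partition R modulo Z.  Their indices c_i
    over Z and n = |R/Z| satisfy sum c_i = n + 5, and c_i c_j divides n for
    i <> j.  For y outside C_i, the coset y + C_i meets each other C_j in at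
    most one coset of Z, so c_i <= 5.  The only solution is n = 25, c_i = 5,
    whence Pr(R) = (25 + 24 * 5) / 25^2. *)
Require Import Defs.
From HB Require Import structures.
From mathcomp Require Import all_boot all_order all_algebra all_fingroup.
From mathcomp Require Import zify ring.

Set Implicit Arguments.
Unset Strict Implicit.
Unset Printing Implicit Defensive.

Import GRing.Theory.

Local Open Scope ring_scope.

(** * Commutators, and centralizers as additive subgroups *)

Definition rcomm (R : finRng) (x y : R) : R := rmul x y - rmul y x.

Lemma rcommDl (R : finRng) (x y z : R) :
  rcomm (x + y) z = rcomm x z + rcomm y z.
Proof. by rewrite /rcomm rmulDl rmulDr opprD addrACA. Qed.

Lemma rcommDr (R : finRng) (x y z : R) :
  rcomm x (y + z) = rcomm x y + rcomm x z.
Proof. by rewrite /rcomm rmulDl rmulDr opprD addrACA. Qed.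

Lemma rcommxx (R : finRng) (x : R) : rcomm x x = 0.
Proof. exact: subrr. Qed.

Lemma rcomm_opp (R : finRng) (x y : R) : rcomm y x = - rcomm x y.
Proof. by rewrite /rcomm opprB. Qed.

Lemma rcomm0r (R : finRng) (x : R) : rcomm x 0 = 0.
Proof. by apply: (addrI (rcomm x 0)); rewrite -rcommDr !addr0. Qed.

Lemma rcomm_sym (R : finRng) (x y : R) : (rcomm y x == 0) = (rcomm x y == 0).
Proof. by rewrite rcomm_opp oppr_eq0. Qed.

Lemma rcommBr (R : finRng) (x y z : R) :
  rcomm x (y - z) = rcomm x y - rcomm x z.
Proof. by apply/eqP; rewrite eq_sym subr_eq -rcommDr subrK. Qed.

Lemma in_rcentralizer (R : finRng) (x y : R) :
  (y \in rcentralizer x) = (rcomm x y == 0).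
Proof. by rewrite inE subr_eq0. Qed.

Lemma in_rcenter (R : finRng) (x : R) :
  (x \in rcenter R) = [forall y, rcomm x y == 0].
Proof.
apply/bigcapP/forallP => xZ y; first by rewrite rcomm_sym -in_rcentralizer xZ.
by rewrite in_rcentralizer rcomm_sym.
Qed.

Lemma rcentralizer_group_set (R : finRng) (x : R) :
  group_set (rcentralizer x).
Proof.
apply/group_setP; split; first by rewrite in_rcentralizer rcomm0r.
move=> a b; rewrite !in_rcentralizer rcommDr => /eqP-> /eqP->.
by rewrite addr0.
Qed.

Canonical rcentralizer_group (R : finRng) (x : R) : {group R} :=
  Group (rcentralizer_group_set x).

Lemma rcenter_sub (R : finRng) (x : R) : rcenter R \subset rcentralizer x.
Proof. exact: bigcap_inf. Qed.

Lemma rcentralizer_eqT (R : finRng) (x : R) :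
  (rcentralizer x == [set: R]) = (x \in rcenter R).
Proof.
rewrite in_rcenter eqEsubset subsetT.
apply/subsetP/forallP => h y; first by rewrite -in_rcentralizer h ?inE.
by rewrite in_rcentralizer h.
Qed.

(** * Commutativity of the proper centralizers *)

Section SevenCentralizers.

Variables (R : finRng) (hcent : n_centralizer 7 R).
Implicit Types x y u v : R.

(** Stated for a single noncommuting pair, so that it can be applied in turn to [(u, v)], [(v, u)]
    and [(u + v, v)]. *)
Lemma rcomm_noncommuting_eq x y u v :
  rcomm x u = 0 -> rcomm x v = 0 -> rcomm u v != 0 -> rcomm x y != 0 ->
  rcomm y u = rcomm y x.
Proof.
move=> xu xv uv xy.
have [ux vx] : rcomm u x = 0 /\ rcomm v x = 0.
  by split; apply/eqP; rewrite rcomm_sym ?xu ?xv.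
have vu : rcomm v u != 0 by rewrite rcomm_sym.
have yx : rcomm y x != 0 by rewrite rcomm_sym.
pose l := [:: rcentralizer 0; rcentralizer x; rcentralizer u; rcentralizer v;
  rcentralizer (u + v); rcentralizer y; rcentralizer (x + y)].
(* f separates the members of l, whatever the undetermined booleans of fl. *)
pose f (B : {set R}) := (x \in B, u \in B, v \in B, y \in B).
have rcomm0l z : rcomm 0 z = 0 by apply/eqP; rewrite rcomm_sym rcomm0r.
set fl := [:: (true, true, true, true); (true, true, true, false);
    (true, true, false, y \in rcentralizer u);
    (true, false, true, y \in rcentralizer v);
    (true, false, false, y \in rcentralizer (u + v));
    (false, u \in rcentralizer y, v \in rcentralizer y, true);
    (false, u \in rcentralizer (x + y), v \in rcentralizer (x + y), false)].
have fE : map f l = fl.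
  rewrite /= /f /fl !in_rcentralizer !rcommDl !rcomm0l !rcommxx xu xv ux vx.
  by rewrite !(add0r, addr0) (negPf uv) (negPf vu) (negPf xy) (negPf yx) !eqxx.
(* Being distinct, the seven members of [l] exhaust [rCent R], so any centralizer can be located in
   [l] by its value under [f]. *)
have lP z : exists i : 'I_7,
    rcentralizer z = nth set0 l i /\ f (rcentralizer z) = nth (f set0) fl i.
  have lu : uniq l.
    apply: (@map_uniq _ _ f); rewrite fE /fl.
    by do !case: (_ \in rcentralizer _).
  have sub : {subset l <= enum (rCent R)}.
    by apply/allP; rewrite /= !mem_enum !imset_f.
  have [|_ lE] := uniq_min_size lu sub; first by rewrite -cardE hcent.
  have : rcentralizer z \in l by rewrite lE mem_enum imset_f.
  case/(nthP set0) => i i7 <-; exists (Ordinal i7).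
  by rewrite -fE (nth_map set0).
(* [x + u] commutes with [x] and [u] but not with [v]; only the third entry of [fl] starts with
   true, true, false. *)
have Cxu : rcentralizer (x + u) = rcentralizer u.
  have [[i i7]] := lP (x + u); rewrite {1}/f !in_rcentralizer !rcommDl !rcommxx.
  rewrite xu xv ux !(add0r, addr0) (negPf uv) !eqxx => -[].
  by case: i i7 => [|[|[|[|[|[|[|i]]]]]]].
have yu : rcomm y u != 0.
  apply: contra yx => yu; have : y \in rcentralizer u.
    by rewrite in_rcentralizer rcomm_sym.
  rewrite -{1}Cxu in_rcentralizer rcommDl rcomm_sym.
  by rewrite rcomm_sym in yu; rewrite -rcomm_sym (eqP yu) addr0 rcomm_sym.
(* Neither [x] nor [y] commutes with [y + u]; only the last entry of [fl] is false at both
   places. *)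
have Cyu : rcentralizer (y + u) = rcentralizer (x + y).
  have [[i i7]] := lP (y + u); rewrite {1}/f !in_rcentralizer !rcommDl !rcommxx.
  rewrite ux !(add0r, addr0) (negPf yx) (rcomm_sym y u) (negPf yu) => -[].
  by case: i i7 => [|[|[|[|[|[|[|i]]]]]]].
(* [y + u, x + y] expands to [y, x] - [y, u]. *)
have : x + y \in rcentralizer (y + u).
  by rewrite Cyu in_rcentralizer rcommxx.
rewrite in_rcentralizer rcommDr !rcommDl rcommxx ux addr0 add0r.
by rewrite (rcomm_opp y u) subr_eq0 => /eqP.
Qed.

Lemma rcentralizer_abelian x u v :
  x \notin rcenter R -> u \in rcentralizer x -> v \in rcentralizer x ->
  rcomm u v = 0.
Proof.
rewrite in_rcenter => /forallPn[y xy]; rewrite !in_rcentralizer.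
move=> /eqP xu /eqP xv; apply/eqP; apply: contraT => uv.
have := rcommDr y u v; rewrite (rcomm_noncommuting_eq xu xv uv xy).
rewrite (rcomm_noncommuting_eq xv xu _ xy); last by rewrite rcomm_sym.
(* The partner [v] works for [u + v] because [u + v, v] = [u, v]. Additivity then reads [y, x] =
   [y, x] + [y, x]. *)
rewrite (@rcomm_noncommuting_eq x y (u + v) v) //; first last.
- by rewrite rcommDl rcommxx addr0.
- by rewrite rcommDr xu xv addr0.
rewrite -{1}[rcomm y x]addr0 => /addrI /esym /eqP.
by rewrite rcomm_sym (negPf xy).
Qed.

(** Both centralizers are abelian and each contains [x] and [u]. Hence commuting is an equivalence
    relation on the non-central elements. *)
Lemma rcentralizer_eq x u :
  x \notin rcenter R -> u \notin rcenter R -> u \in rcentralizer x ->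
  rcentralizer u = rcentralizer x.
Proof.
move=> xZ uZ ux; apply/setP => s; rewrite !in_rcentralizer.
apply/eqP/eqP => h; apply: rcentralizer_abelian.
- exact: uZ.
- by rewrite in_rcentralizer rcomm_sym -in_rcentralizer.
- by rewrite in_rcentralizer h.
- exact: xZ.
- by [].
- by rewrite in_rcentralizer h.
Qed.

(** * The partition of the non-central elements by proper centralizers *)

Definition proper_rCent : {set {set R}} := rCent R :\ [set: R].

Lemma proper_rCentP A :
  reflect (exists2 x, x \notin rcenter R & A = rcentralizer x)
    (A \in proper_rCent).
Proof.
rewrite !inE; apply: (iffP andP) => [[AT /imsetP[x _ Ax]]|[x xZ ->]].
  by exists x => //; rewrite -rcentralizer_eqT -Ax.
by rewrite rcentralizer_eqT xZ imset_f.
Qed.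

Lemma card_proper_rCent : #|proper_rCent| = 6.
Proof.
have : [set: R] \in rCent R.
  apply/imsetP; exists 0 => //; apply/esym/eqP; rewrite rcentralizer_eqT.
  exact: (group1 (rcenter_group R)).
move=> T; have := cardsD1 [set: R] (rCent R).
by rewrite hcent T => -[].
Qed.

Lemma mem_proper_rCent A x :
  A \in proper_rCent -> x \notin rcenter R -> (x \in A) = (rcentralizer x == A).
Proof.
case/proper_rCentP => y yZ -> xZ.
apply/idP/eqP => [|<-]; first exact: rcentralizer_eq.
by rewrite in_rcentralizer rcommxx.
Qed.

Lemma proper_rCentI A B :
  A \in proper_rCent -> B \in proper_rCent -> A != B -> A :&: B = rcenter R.
Proof.
move=> Ap Bp AB; apply/eqP; rewrite eqEsubset; apply/andP; split.
  apply/subsetP => x /setIP[xA xB]; apply: contraR AB => xZ.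
  move: xA xB; rewrite (mem_proper_rCent Ap xZ) (mem_proper_rCent Bp xZ).
  by move=> /eqP<- /eqP<-.
case/proper_rCentP: Ap Bp => x _ -> /proper_rCentP[y _ ->].
by rewrite subsetI !rcenter_sub.
Qed.

(** * Indices over the center *)

Lemma card_proper_rCentE A :
  A \in proper_rCent -> #|A| = (#|rcenter R| * #|A : rcenter R|%g)%N.
Proof. by case/proper_rCentP => x _ ->; rewrite Lagrange // rcenter_sub. Qed.

Lemma card_rcenter_index : #|R| = (#|rcenter R| * #|[set: R] : rcenter R|%g)%N.
Proof. by rewrite -cardsT Lagrange // subsetT. Qed.

(** The orders of the six centralizers add up to 6|Z| + |R \ Z| = |R| + 5|Z|; divide by |Z|. *)
Lemma sum_proper_rCent_index :
  (\sum_(A in proper_rCent) #|A : rcenter R|%g =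
   #|[set: R] : rcenter R|%g + 5)%N.
Proof.
have z0 : (0 < #|rcenter R|)%N by apply: cardG_gt0.
apply/eqP; rewrite -(eqn_pmul2l z0) big_distrr /=.
have -> : (\sum_(A in proper_rCent) #|rcenter R| * #|A : rcenter R|%g =
           \sum_(A in proper_rCent) (#|rcenter R| + #|A :\: rcenter R|%g))%N.
  apply: eq_bigr => A Ap; rewrite -card_proper_rCentE //.
  rewrite -(cardsID (rcenter R) A).
  case/proper_rCentP: Ap => x _ ->.
  by rewrite (setIidPr (rcenter_sub x)).
rewrite big_split /= sum_nat_const card_proper_rCent.
(* The fibre of [rcentralizer] over [A], on non-central elements, is [A] minus the center. *)
have <- : (#|~: rcenter R|%g = \sum_(A in proper_rCent) #|A :\: rcenter R|%g)%N.
  rewrite -sum1_card.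
  rewrite (partition_big (@rcentralizer R) (mem proper_rCent)) /=; last first.
    by move=> x; rewrite inE => xZ; apply/proper_rCentP; exists x.
  apply: eq_bigr => A Ap; rewrite -sum1_card; apply: eq_bigl => x.
  rewrite !inE; case: (boolP (x \in rcenter R)) => //= xZ.
  by rewrite mem_proper_rCent.
move: (cardsC (rcenter R)); rewrite card_rcenter_index; set n := #|_ : _|%g.
by move: z0; set z := #|_|; set w := #|_| => z0 zw; apply/eqP; lia.
Qed.

(** Since A and B meet in Z, the subgroup A + B has order |A||B|/|Z|, which divides |R|. *)
Lemma proper_rCent_index_dvd A B :
  A \in proper_rCent -> B \in proper_rCent -> A != B ->
  (#|A : rcenter R|%g * #|B : rcenter R|%g %| #|[set: R] : rcenter R|%g)%N.
Proof.
move=> Ap Bp AB; have z0 : (0 < #|rcenter R|)%N by apply: cardG_gt0.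
have := proper_rCentI Ap Bp AB; have := card_proper_rCentE Ap.
have := card_proper_rCentE Bp.
case/proper_rCentP: Ap Bp {AB} => x _ -> /proper_rCentP[y _ ->].
set G := rcentralizer_group x; set H := rcentralizer_group y.
move=> cH cG GH; rewrite -(dvdn_pmul2l z0) -card_rcenter_index -cardsT.
have GHC : commute G H.
  by apply: normC; apply: cents_norm; apply/centsP => a _ b _; apply: addrC.
have : (#|(G <*> H)%g| %| #|[set: R]|)%N by apply: cardSg; apply: subsetT.
rewrite comm_joingE //; congr (_ %| _)%N.
apply/eqP; rewrite -(eqn_pmul2r z0) -{1}GH; apply/eqP.
by rewrite -mul_cardG cG cH mulnACA [RHS]mulnAC.
Qed.

Lemma proper_rCent_index_ge2 A :
  A \in proper_rCent -> (1 < #|A : rcenter R|%g)%N.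
Proof.
case/proper_rCentP => x xZ ->; rewrite indexg_gt1.
apply: contra xZ => /subsetP; apply.
by rewrite in_rcentralizer rcommxx.
Qed.

(** For y outside A, the map sending a to C(y + a) takes A into the five other proper centralizers,
    with fibres of size at most |Z|. *)
Lemma proper_rCent_index_le5 A :
  A \in proper_rCent -> (#|A : rcenter R|%g <= 5)%N.
Proof.
move=> Ap; have z0 : (0 < #|rcenter R|)%N by apply: cardG_gt0.
rewrite -(leq_pmul2l z0) -card_proper_rCentE //.
have /proper_rCentP[x xZ Ax] := Ap.
have [y yA] : exists y, y \notin A.
  apply/existsP; rewrite -negb_forall; apply: contra xZ => /forallP h.
  by rewrite -rcentralizer_eqT -Ax eqEsubset subsetT; apply/subsetP => s _.
have yaA a : a \in A -> y + a \notin A.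
  rewrite Ax => aA; apply: contra yA => yaA; rewrite Ax -(addrK a y).
  by apply: (groupM yaA); rewrite groupV.
have yaZ a : a \in A -> y + a \notin rcenter R.
  move=> /yaA; apply: contra; rewrite Ax; exact: (subsetP (rcenter_sub x)).
rewrite -sum1_card.
rewrite (partition_big (fun a => rcentralizer (y + a))
  (mem (proper_rCent :\ A))) /=.
  have -> : (#|rcenter R| * 5 = \sum_(B in proper_rCent :\ A) #|rcenter R|)%N.
    rewrite sum_nat_const mulnC; congr (_ * _)%N.
    by move: (cardsD1 A proper_rCent); rewrite card_proper_rCent Ap => -[].
  apply: leq_sum => B; rewrite in_setD1 => /andP[BA Bp].
  rewrite sum1dep_card; set F := [set _ | _].
  have [->|[a0]] := set_0Vmem F; first by rewrite cards0.
  rewrite inE => /andP[a0A /eqP a0B].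
  (* The difference of [a] and [a0] is (y + a) - (y + a0), which lies in B as well as in A, hence in
     Z: the fibre sits inside one coset of Z. *)
  rewrite -(card_lcoset (rcenter R) a0); apply: subset_leq_card.
  apply/subsetP => a; rewrite inE => /andP[aA /eqP aB].
  rewrite mem_lcoset -(proper_rCentI Bp Ap BA) inE; apply/andP; split.
    rewrite -aB in_rcentralizer.
    have -> : (a0^-1 * a)%g = (y + a) - (y + a0).
      by rewrite opprD addrACA subrr add0r addrC.
    rewrite rcommBr rcommxx sub0r oppr_eq0 -in_rcentralizer aB -a0B.
    by rewrite in_rcentralizer rcommxx.
  by move: a0A aA; rewrite Ax => a0A aA; rewrite groupM ?groupV.
move=> a aA; rewrite in_setD1; apply/andP; split.
  apply: contra (yaA _ aA) => /eqP <-; by rewrite in_rcentralizer rcommxx.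
by apply/proper_rCentP; exists (y + a); rewrite ?yaZ.
Qed.

(* sumn s - 5 is the order of the group R/Z partitioned by the six subgroups. *)
Lemma partition_indices_eq (s : seq nat) :
  size s = 6 -> all [pred i | 1 < i <= 5]%N s ->
  pairwise (fun i j => i * j %| sumn s - 5)%N s -> s = nseq 6 5%N.
Proof.
have mem4 i : (1 < i <= 5)%N -> i \in [:: 2; 3; 4; 5]%N.
  by case: i => [|[|[|[|[|[|i]]]]]].
case: s => [|a [|b [|c [|d [|e [|f [|? ?]]]]]]] //= _.
case/and5P => /mem4 + /mem4 + /mem4 + /mem4 + /and3P[/mem4 + /mem4 + _].
move: a b c d e f.
pose L := [:: 2; 3; 4; 5]%N.
pose P s := pairwise (fun i j => i * j %| sumn s - 5)%N s ==> (s == nseq 6 5%N).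
(* Evaluation of all 4^6 candidates. Entries are at least 2, so the sum is at least 12 and the
   subtraction of 5 is not truncated. *)
have /allP ha : all (fun a => all (fun b => all (fun c => all (fun d =>
  all (fun e => all (fun f => P [:: a; b; c; d; e; f]) L) L) L) L) L) L.
  by vm_compute.
move=> a b c d e f /ha /allP hb /hb /allP hc /hc /allP hd /hd /allP he.
by move=> /he /allP hf /hf /implyP h /h /eqP.
Qed.

Lemma proper_rCent_indices :
  [seq #|A : rcenter R|%g | A <- enum proper_rCent] = nseq 6 5%N.
Proof.
have sumE : sumn [seq #|A : rcenter R|%g | A <- enum proper_rCent] =
    (#|[set: R] : rcenter R|%g + 5)%N.
  by rewrite sumnE big_map big_enum /= sum_proper_rCent_index.
apply: partition_indices_eq; rewrite ?sumE ?addnK.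
- by rewrite size_map -cardE card_proper_rCent.
- apply/allP => _ /mapP[A + ->]; rewrite mem_enum /= => Ap.
  by rewrite proper_rCent_index_ge2 ?proper_rCent_index_le5.
(* The enumeration has no duplicates, which supplies the hypothesis [A != B] of the divisibility
   lemma. *)
- rewrite pairwise_map; have := enum_uniq proper_rCent; rewrite uniq_pairwise.
  apply: (@sub_in_pairwise _ (mem proper_rCent)) => [A B|]; last first.
    by apply/allP => A; rewrite mem_enum.
  exact: proper_rCent_index_dvd.
Qed.

Lemma rcenter_index : #|[set: R] : rcenter R|%g = 25.
Proof.
(* With 5 added, both sides equal 6 * 5 = 30. *)
apply/eqP; rewrite -(eqn_add2r 5) -sum_proper_rCent_index -big_enum /=.
rewrite -(big_map (fun A => #|A : rcenter R|%g) xpredT id).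
by rewrite proper_rCent_indices unlock.
Qed.

Lemma card_rcentralizer x :
  x \notin rcenter R -> #|rcentralizer x| = (#|rcenter R| * 5)%N.
Proof.
move=> xZ; have Cp : rcentralizer x \in proper_rCent.
  by apply/proper_rCentP; exists x.
rewrite card_proper_rCentE //; congr (_ * _)%N.
have : #|rcentralizer x : rcenter R|%g \in
    [seq #|A : rcenter R|%g | A <- enum proper_rCent].
  by apply: map_f; rewrite mem_enum.
by rewrite proper_rCent_indices mem_nseq => /eqP.
Qed.

End SevenCentralizers.

(** * Commuting pairs and the commuting probability *)

Lemma card_commuting_pairs (R : finRng) :
  #|[set rs : R * R | rmul rs.1 rs.2 == rmul rs.2 rs.1]| =
  (\sum_(x : R) #|rcentralizer x|)%N.
Proof.
rewrite -sum1_card.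
rewrite (eq_bigr (fun x => \sum_(y in rcentralizer x) 1)%N); last first.
  by move=> x _; rewrite sum1_card.
by rewrite pair_big_dep /=; apply: eq_bigl => -[x y]; rewrite !inE.
Qed.

Theorem theorem3p6 (R : finRng)
    (hcent : n_centralizer 7 R)
    (hquot : ~~ (([set: R] / rcenter R)%g \isog [set: 'Z_2 * 'Z_2 * 'Z_6])) :
  commuting_probability R = 29%:R / 125%:R.
Proof.
have z0 : (0 < #|rcenter R|)%N by apply: cardG_gt0.
have cR : #|R| = (#|rcenter R| * 25)%N.
  by rewrite card_rcenter_index rcenter_index.
have cN := cardsC (rcenter R).
(* With z = |Z|, there are z central elements with centralizer of order 25z and 24z others with
   centralizer of order 5z; 145 = 25 + 24 * 5, and 145/625 = 29/125. *)
have sumE : (\sum_(x : R) #|rcentralizer x| = 145 * #|rcenter R| ^ 2)%N.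
  rewrite (bigID (mem (rcenter R))) /=.
  rewrite (eq_bigr (fun=> #|R|)) => [|x]; last first.
    by rewrite -rcentralizer_eqT => /eqP->; rewrite cardsT.
  rewrite [X in (_ + X)%N](eq_bigr (fun=> (#|rcenter R| * 5)%N)); last first.
    exact: card_rcentralizer.
  rewrite [X in (_ + X)%N](eq_bigl (mem (~: rcenter R))) => [|x]; last first.
    by rewrite !inE.
  rewrite !sum_nat_const; have -> : #|~: rcenter R| = (#|rcenter R| * 24)%N.
    by apply: (@addnI #|rcenter R|); rewrite cN cR -mulnS.
  by rewrite cR; ring.
rewrite /commuting_probability card_commuting_pairs sumE cR.
have : #|rcenter R|%:R != 0 :> rat by rewrite Num.Theory.pnatr_eq0 -lt0n.
by rewrite !natrM => nz; field.
Qed.
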